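(* Let $k\ge 2$ be an integer and $0<\beta<1$ a real number. Let $A\subset (0,1)$ be a set with $\mu^*(A)>\beta/k$ and let $B\subset (0,1)$ be an open set with $\mu(B)\ge 1-\beta$. Then there exist $k$ elements $\alpha_1,\alpha_2,\ldots,\alpha_k$ of $A$ (not necessarily distinct) such that $$\alpha_1+\alpha_2+\cdots+\alpha_k \pmod{1}\in B.$$
   Context: $\mu$ denotes Lebesgue measure on $\mathbb{R}$ and $\mu^*$ denotes Lebesgue outer measure. For a real number $x$, ''$x \pmod 1$'' denotes its fractional part $x-\lfloor x\rfloor\in[0,1)$. *)

(* Defs.v *)
From HB Require Import structures.
From mathcomp Require Export all_boot all_order all_algebra.
From mathcomp Require Export all_classical all_reals all_analysis.

Set Implicit Arguments.
Unset Strict Implicit.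
Unset Printing Implicit Defensive.

Export Order.TTheory GRing.Theory Num.Theory.
Export numFieldNormedType.Exports.

Local Open Scope ring_scope.

(* Infimum of the total lengths of the countable covers of A by intervals
   ]a, b]; covers by open intervals give the same value
   (outer_measure_open_itv_cover in measurable_realfun). *)
Definition lebesgue_outer_measure {R : realType} (A : set R) : \bar R :=
  ((@wlength R idfun)^*)%mu A.

Definition fract {R : realType} (x : R) : R := x - (Num.floor x)%:~R.

(* Main.v *)
(* Discretise at scale 1/p for a large prime p: let A' be the set of residues j
   whose cell ]j/p, (j+1)/p] meets A, and G the set of those whose cell meets
   B_e = {x | ]x - e, x + e[ is contained in B}. Covering by cells gives |A'|
   >= p mu^*(A) and |G| >= p mu(B_e), and mu(B_e) tends to mu(B) as e -> 0. By
   Cauchy-Davenport the k-fold sumset of A' in Z/p has at least min(p, k|A'| -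
   k + 1) elements, so for large p it must meet G. A common element yields a
   sum of k elements of A within k/p < e of B_e modulo 1, hence in B modulo 1. *)

Require Import Defs.
From mathcomp Require Import all_boot all_order all_algebra.
From mathcomp Require Import all_classical all_reals all_analysis.
From mathcomp Require Import zify lra.
Import Order.TTheory GRing.Theory Num.Theory.
Import numFieldNormedType.Exports.

Set Implicit Arguments.
Unset Strict Implicit.
Unset Printing Implicit Defensive.

Local Open Scope classical_set_scope.
Local Open Scope ring_scope.

(** The multiples of a nonzero [d] exhaust the prime field, so the orbit of one point of [A] under
    translation by [d] is everything. *)
Lemma Fp_translate_stable (p : nat) (A : {set 'F_p}) (d : 'F_p) : prime p ->
  d != 0 -> A != finset.set0 -> (forall a, a \in A -> a + d \in A) -> A = finset.setT.
Proof.
move=> pp d0 /set0Pn[a aA] Ad; apply/setP => x; rewrite finset.in_setT.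
have Am n : a + d *+ n \in A.
  by elim: n => [|n IHn]; rewrite ?addr0// mulrSr addrA Ad.
have -> : x = a + d *+ ((x - a) / d)%R by rewrite -mulr_natr natr_Zp mulrC divfK// subrKC.
exact: Am.
Qed.

(* Dyson's e-transform: with [a = e + b1] in [A] and [e + b2] outside [A], the
   pair [(A :|: (e + B), B :&: (A - e))] has the same total cardinality, a
   smaller second component, and a sumset contained in [A + B]. *)
Lemma cauchy_davenport (p : nat) (A B : {set 'F_p}) : prime p ->
  A != finset.set0 -> B != finset.set0 ->
  (minn p (#|A| + #|B|).-1 <= #|[set (a + b)%R | a in A, b in B]%SET|)%N.
Proof.
move=> pp; have [n] := ubnP #|B|; elim: n A B => // n IHn A B ltBn A0 B0.
have [b1 b1B] := set0Pn _ B0.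
(* The translate of [A] by [b1] lies in the sumset; this settles both the case of a one-element [B]
   and the case where [A] is the whole field. *)
have translate_sub : (#|A| <= #|[set (a + b)%R | a in A, b in B]%SET|)%N.
  rewrite -(card_imset (mem A) (addIr b1)).
  by apply/subset_leq_card/fintype.subsetP => _ /imsetP[a aA ->]; apply: imset2_f.
have [B1|B2] := leqP #|B| 1.
  by apply: leq_trans translate_sub; have := geq_minr p (#|A| + #|B|).-1; lia.
have /set0Pn[b2 /setD1P[b21 b2B]] : B :\ b1 != finset.set0.
  by move: B2; rewrite -card_gt0 (cardsD1 b1) b1B.
have [AT|AT] := eqVneq A finset.setT.
  apply: leq_trans translate_sub; rewrite AT cardsT card_Fp//; exact: geq_minl.
have /existsP[a /andP[aA abA]] : [exists a, (a \in A) && (a + (b2 - b1) \notin A)].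
  rewrite -[X in is_true X]negbK; apply: contraNN AT => /existsPn AP.
  apply/eqP/(@Fp_translate_stable p A (b2 - b1)) => //; first by rewrite subr_eq0.
  by move=> a aA; have := AP a; rewrite aA negbK.
pose e := a - b1.
pose eB := [set e + b | b in B]%SET; pose A' := A :|: eB.
pose B' := [set b in B | e + b \in A]%SET.
have b1B' : b1 \in B' by rewrite inE b1B subrK.
have b2B' : b2 \notin B' by rewrite inE b2B /= /e -addrA (addrC (- b1)).
have cardI : #|A :&: eB| = #|B'|.
  rewrite -(card_imset (mem B') (addrI e)); apply: eq_card => x.
  apply/setIP/imsetP => [[xA /imsetP[b bB xE]]|[b]].
    by exists b => //; rewrite inE bB -xE.
  by rewrite inE => /andP[bB ebA] ->; split=> //; apply: imset_f.
have cardE : (#|A'| + #|B'| = #|A| + #|B|)%N.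
  rewrite -cardI cardsUI; congr (_ + _)%N; exact: (card_imset _ (addrI e)).
have ltB' : (#|B'| < #|B|)%N.
  apply/proper_card/properP; split; last by exists b2.
  by apply/fintype.subsetP => x; rewrite inE => /andP[].
rewrite -cardE; apply: leq_trans (IHn A' B' _ _ _) _.
- exact: leq_trans ltB' _.
- by apply/set0Pn; exists a; rewrite !inE aA.
- by apply/set0Pn; exists b1.
(* For [x = e + c], regroup [(e + c) + b] as [(e + b) + c]: here [e + b] is in [A] by definition of
   [B'], and [c] is in [B]. *)
apply/subset_leq_card/fintype.subsetP => _ /imset2P[x b xA' + ->].
rewrite inE => /andP[bB ebA]; case/setUP: xA' => [xA|/imsetP[c cB ->]].
  exact: imset2_f.
by rewrite addrAC; apply: imset2_f.
Qed.

(** Each of the [k] uses of [cauchy_davenport], starting from the singleton of 0, adds [#|A| - 1]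
    elements until [p] is reached. *)
Lemma iterated_sumset_card (p : nat) (A : {set 'F_p}) (k : nat) : prime p ->
  A != finset.set0 ->
  exists S : {set 'F_p}, (minn p (k * #|A|.-1).+1 <= #|S|)%N /\
    (forall s, s \in S -> exists f : 'I_k -> 'F_p,
       (forall i, f i \in A) /\ s = \sum_(i < k) f i).
Proof.
move=> pp A0; elim: k => [|k [S [cardS SP]]].
  exists [set 0]%SET; rewrite cards1 geq_minr; split=> // s /set1P ->.
  by exists (fun=> 0); split; [case|rewrite big_ord0].
have pgt0 := prime_gt0 pp.
have S0 : S != finset.set0 by rewrite -card_gt0 (leq_trans _ cardS)// leq_min pgt0.
exists [set (a + s)%R | a in A, s in S]%SET; split.
  apply: (leq_trans _ (cauchy_davenport pp A0 S0)).
  have : (0 < #|A|)%N by rewrite card_gt0.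
  rewrite mulSn; move: cardS; set m := (k * _)%N; lia.
move=> _ /imset2P[a s aA /SP[f [fA ->]] ->].
exists (fun i => if unlift ord0 i is Some j then f j else a); split.
  by move=> i; case: unliftP.
rewrite big_ord_recl unlift_none; congr (_ + _).
by apply: eq_bigr => i _; rewrite liftK.
Qed.

Definition cell (R : realType) (p j : nat) : set R :=
  `]j%:R / p%:R, j.+1%:R / p%:R].

Definition meeting_cells (R : realType) (p : nat) (E : set R) : {set 'F_p} :=
  [set j : 'F_p | `[< exists2 x, E x & cell p j x >]]%SET.

Lemma lebesgue_measure_cell (R : realType) (p j : nat) : (0 < p)%N ->
  lebesgue_measure (cell p j : set R) = (p%:R^-1)%:E.
Proof.
move=> p0; rewrite lebesgue_measure_itv /= lte_fin ltr_pM2r ?invr_gt0 ?ltr0n//.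
by rewrite ltr_nat ltnSn -EFinB -mulrBl -natrB// subSnn mul1r.
Qed.

Lemma cell_ex (R : realType) (p : nat) (x : R) : (0 < p)%N -> 0 < x < 1 ->
  exists2 j, (j < p)%N & cell p j x.
Proof.
move=> p0 /andP[x0 x1]; have pR : 0 < p%:R :> R by rewrite ltr0n.
have := ceil_itv (x * p%:R); have := ceil_gt0 (x * p%:R); rewrite mulr_gt0//.
case: (Num.ceil _) => // -[//|j] _; rewrite -addn1 PoszD addrK => /andP[jx xj].
exists j.
  by rewrite -(ltr_nat R) (lt_le_trans jx)// ler_piMl ?ltW.
by rewrite /cell/= in_itv/= ltr_pdivrMr// ler_pdivlMr// jx -addn1.
Qed.

Lemma outer_measure_le_meeting_cells (R : realType) (p : nat) (E : set R) :
  prime p -> E `<=` `]0, 1[ ->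
  (lebesgue_outer_measure E <= (#|meeting_cells p E|%:R / p%:R)%:E)%E.
Proof.
move=> pp E01; have p0 := prime_gt0 pp.
pose C (j : 'F_p) : set R := cell p j.
apply: (@le_trans _ _
    (lebesgue_outer_measure (\big[setU/set0]_(j in meeting_cells p E) C j))).
  apply: le_mu_ext => x Ex; rewrite -bigcup_pred.
  have [|j jp jx] := @cell_ex R p x p0; first by have := E01 _ Ex; rewrite /= in_itv.
  have vj : ((j%:R : 'F_p) = j :> nat) by rewrite val_Fp_nat// modn_small.
  exists (j%:R : 'F_p); last by rewrite /C vj.
  by rewrite /= inE; apply/asboolP; exists x; rewrite ?vj.
apply: (@le_trans _ _ (\sum_(j in meeting_cells p E) (p%:R^-1)%:E)%E).
  apply: (big_ind2 (fun X y => lebesgue_outer_measure X <= y)%E).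
  - by rewrite /lebesgue_outer_measure outer_measure0.
  - by move=> X1 y1 X2 y2 h1 h2; apply: le_trans (leeD h1 h2); exact: outer_measureU2.
  (* [lebesgue_measure] is by conversion this outer measure, so the length of a cell applies
     directly. *)
  - by move=> j _; rewrite -(lebesgue_measure_cell R j p0).
by rewrite sumEFin sumr_const mulr_natl.
Qed.

(** Continuity from below: as [B] is open, it is the increasing union of the sets of points whose
    ball of radius [1/(n+1)] stays in [B]. *)
Lemma lebesgue_measure_core (R : realType) (B : set R) (c : R) : open B ->
  (c%:E < lebesgue_measure B)%E ->
  exists e : R, 0 < e /\
    (c%:E < lebesgue_measure [set x | ball x e `<=` B])%E.
Proof.
move=> Bo cB.
(* Stated through distances to the complement of [B], the set is an intersection of closed sets,
   hence measurable. *)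
pose E n : set R := [set x | forall y, ~ B y -> n.+1%:R^-1 <= `|x - y| ].
have EB n : E n = [set x | ball x n.+1%:R^-1 `<=` B].
  apply/seteqP; split=> x /= h y.
    rewrite /ball/= => xy; apply: contrapT => /h; rewrite leNgt; exact/negP/negPn.
  move=> By; rewrite leNgt; apply/negP => xy; exact/By/h.
have mE n : measurable (E n).
  apply: measurable_realfun.closed_measurable.
  have -> : E n = \bigcap_(y in ~` B) [set x | n.+1%:R^-1 <= `|x - y| ] by [].
  apply: closed_bigI => y _.
  apply: (@closed_comp _ _ (fun x : R => `|x - y|) [set z | n.+1%:R^-1 <= z]).
    move=> x _; apply: cvg_norm; apply: cvgB; [exact: cvg_id|exact: cvg_cst].
  exact: closed_ge.
have UE : \bigcup_n E n = B.
  apply/seteqP; split=> [x [n _]|x Bx].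
    by rewrite EB => /(_ x); apply; exact: ballxx.
  have /nbhs_ballP[e /= e0 eB] : nbhs x B by exact: open_nbhs_nbhs.
  have [n] := ltr_add_invr e0; rewrite add0r => ne.
  by exists n => //; rewrite EB => y /= xy; apply: eB; apply: le_ball xy; exact: ltW.
have nd : {homo E : n m / (n <= m)%N >-> (n <= m)%O}.
  move=> n m nm; apply/subsetPset => x Ex y /Ex; apply: le_trans.
  by rewrite lef_pV2 ?posrE ?ltr0n// ler_nat.
have mU : measurable (\bigcup_n E n) by exact: bigcup_measurable.
have /(cvg_unique (@ereal_hausdorff R)) := nondecreasing_cvg_mu (mu := @lebesgue_measure R) mE mU nd.
have /ereal_nondecreasing_cvgn h : {homo @lebesgue_measure R \o E : n m / (n <= m)%N >-> (n <= m)%E}.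
  move=> n m nm; apply: le_measure; rewrite ?inE; [exact: mE|exact: mE|].
  by apply/subsetPset; exact: nd.
move=> /(_ _ h); rewrite UE => mB; move: cB; rewrite mB => /ereal_sup_gt[_ [n _ <-]] cE.
by exists n.+1%:R^-1; rewrite -EB invr_gt0 ltr0n.
Qed.

(** Choosing [alpha i] in the cell of [f i] makes an error of at most [1/p] per term, so the sum
    modulo 1 is within [k/p < e] of a point whose [e]-ball lies in [B]. *)
Lemma fract_sum_meeting_cells (R : realType) (k p : nat) (A B : set R) (e : R)
    (f : 'I_k -> 'F_p) :
  (0 < k)%N -> prime p -> k%:R / p%:R < e -> B `<=` `]0, 1[ ->
  (forall i, f i \in meeting_cells p A) ->
  \sum_(i < k) f i \in meeting_cells p [set x | ball x e `<=` B] ->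
  exists alpha : 'I_k -> R,
    (forall i, A (alpha i)) /\ B (fract (\sum_(i < k) alpha i)).
Proof.
move=> k0 pp kpe B01 fA.
have p0 : 0 < p%:R :> R by rewrite ltr0n prime_gt0.
rewrite inE => /asboolP[x xB]; rewrite /cell /= in_itv /=.
pose N := (\sum_(i < k) f i)%N.
have -> : (\sum_(i < k) f i : 'F_p) = (N %% p)%N :> nat.
  rewrite -val_Fp_nat// /N natr_sum; congr (nat_of_ord _).
  by apply: eq_bigr => i _; rewrite natr_Zp.
move=> /andP[sx xs].
have /choice[alpha alphaP] i : exists a, A a /\ cell p (f i) a.
  by have := fA i; rewrite inE => /asboolP[a Aa ca]; exists a.
exists alpha; split=> [i|]; first by have [] := alphaP i.
(* The quotient [N %/ p] counts the wrap-arounds modulo [p]. It is the floor of the sum only once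
   [y] is known to be in [B], hence in []0, 1[]. *)
pose y := \sum_(i < k) alpha i - (N %/ p)%:R.
have NE : N%:R / p%:R = (N %/ p)%:R + (N %% p)%:R / p%:R :> R.
  by rewrite {1}(divn_eq N p) natrD natrM mulrDl mulfK// gt_eqF.
have yge : (N %% p)%:R / p%:R <= y.
  rewrite lerBrDl -NE /N natr_sum mulr_suml; apply: ler_sum => i _.
  by have [_] := alphaP i; rewrite /cell/= in_itv/= => /andP[/ltW].
have yle : y <= (N %% p)%:R / p%:R + k%:R / p%:R.
  rewrite lerBlDl addrA -NE /N natr_sum -mulrDl.
  rewrite -[X in _ + X%:R]card_ord -sumr_const -big_split mulr_suml.
  apply: ler_sum => i _; have [_] := alphaP i.
  by rewrite /cell/= in_itv/= -natr1 => /andP[].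
have k1 : p%:R^-1 <= k%:R / p%:R :> R by rewrite ler_peMl ?ler1n// invr_ge0 ltW.
have By : B y.
  apply: xB; rewrite /ball/= ltr_norml; move: xs; rewrite -natr1 mulrDl mul1r.
  by move=> xs; apply/andP; split; lra.
suff -> : fract (\sum_(i < k) alpha i) = y by [].
have := B01 _ By; rewrite /= in_itv /= => /andP[y0 y1].
rewrite /fract (@floor_def _ _ (Posz (N %/ p)%N))//.
rewrite intrD -pmulrn.
by move: y0 y1; rewrite /y => y0 y1; apply/andP; split; lra.
Qed.

Theorem theorem2 (R : realType) (k : nat) (beta : R) (A B : set R)
    (hk : (2 <= k)%N) (hbeta0 : 0 < beta) (hbeta1 : beta < 1)
    (hA : A `<=` `]0, 1[) (hAmu : ((beta / k%:R)%:E < lebesgue_outer_measure A)%E)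
    (hB : B `<=` `]0, 1[) (hBo : open B)
    (hBmu : ((1 - beta)%:E <= lebesgue_measure B)%E) :
  exists alpha : 'I_k -> R,
    (forall i, A (alpha i)) /\ B (fract (\sum_(i < k) alpha i)).
Proof.
have k0 : 0 < k%:R :> R by rewrite ltr0n ltnW.
have [c ckb cA] : exists2 c, beta / k%:R < c & (c%:E < lebesgue_outer_measure A)%E.
  case: (lebesgue_outer_measure A) hAmu => // [r|_].
    by rewrite lte_fin => /midf_lt[h1 h2]; exists ((beta / k%:R + r) / 2).
  by exists (beta / k%:R + 1); rewrite ?ltry// ltrDl.
(* [d] is the slack: the first bound gives [k * d <= k * c - beta], the second keeps [1 - beta - d]
   positive, so that [G] is nonempty. *)
pose d := Num.min (c - beta / k%:R) ((1 - beta) / 2).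
have d0 : 0 < d by rewrite lt_min subr_gt0 ckb divr_gt0// subr_gt0.
have dc : beta + k%:R * d <= k%:R * c.
  have : k%:R * d <= k%:R * (c - beta / k%:R) by rewrite ler_pM2l// ge_min lexx.
  by rewrite mulrBr mulrCA divff ?gt_eqF// mulr1; lra.
have db : d <= (1 - beta) / 2 by rewrite ge_min lexx orbT.
have [|e [e0 eB]] := @lebesgue_measure_core R B (1 - beta - d) hBo.
  by apply: lt_le_trans hBmu; rewrite lte_fin ltrBlDr ltrDl.
(* The summand [k / e] ensures [k / p < e], and [1 / d] ensures [d * p > 1]. *)
have [p] := prime_above (Num.bound (k%:R / e + d^-1)); rewrite -(ltr_nat R) => + pp.
move=> /(lt_trans (archi_boundP _)) bp.
have ke0 : 0 < k%:R / e by rewrite divr_gt0.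
have dV0 : 0 < d^-1 by rewrite invr_gt0.
have {}bp := bp (ltW (addr_gt0 ke0 dV0)).
have p0 : 0 < p%:R :> R by rewrite ltr0n prime_gt0.
have dp : 1 < d * p%:R by rewrite mulrC -ltr_pdivrMr// div1r; lra.
have kpe : k%:R / p%:R < e.
  by rewrite ltr_pdivrMr// mulrC -ltr_pdivrMr//; lra.
set E := [set x | ball x e `<=` B] in eB.
have EB : E `<=` B by move=> x; apply; exact: ballxx.
have := lt_le_trans cA (outer_measure_le_meeting_cells pp hA).
have := lt_le_trans eB (outer_measure_le_meeting_cells pp (subset_trans EB hB)).
rewrite !lte_fin !ltr_pdivlMr//.
set A' := meeting_cells p A; set G := meeting_cells p E => hG hA'.
have c0 : 0 < c by apply: lt_trans ckb; rewrite divr_gt0.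
have A'0 : (0 < #|A'|)%N by rewrite -(ltr0n R); apply: lt_trans hA'; rewrite mulr_gt0.
have G0 : (0 < #|G|)%N.
  by rewrite -(ltr0n R); apply: lt_trans hG; rewrite mulr_gt0//; lra.
have [|S [cardS SP]] := @iterated_sumset_card p A' k pp; first by rewrite -card_gt0.
have [SG|] := eqVneq (S :&: G) finset.set0; last first.
  move=> /set0Pn[s /setIP[/SP[f [fA' ->]] fG]].
  exact: (fract_sum_meeting_cells (ltnW hk) pp kpe hB fA' fG).
exfalso.
have SGp : (#|S| + #|G| <= p)%N.
  by rewrite -cardsUI SG cards0 addn0 -[X in (_ <= X)%N](card_Fp pp) max_card.
(* The minimum is not [p]: otherwise [S] would fill the field and leave no room for the nonempty
   [G]. *)
have cS : ((k * #|A'|.-1).+1 <= #|S|)%N.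
  move: cardS; rewrite geq_min => /orP[pS|//].
  have := leq_trans SGp pS.
  by rewrite -[X in (_ <= X)%N]addn0 leq_add2l leqNgt G0.
have := leq_trans (leq_add cS (leqnn #|G|)) SGp.
rewrite -(ler_nat R) natrD -addn1 natrD natrM -subn1 natrB// => hp.
have h1 : k%:R * (c * p%:R) < k%:R * #|A'|%:R by rewrite ltr_pM2l.
(* Disjointness bounds [k * (#|A'| - 1) + 1 + #|G|] by [p], yet the lower bounds on [#|A'|] and
   [#|G|] make it exceed [p + (k - 1) * (d * p - 1)], which is at least [p]. *)
have h2 : (beta + k%:R * d) * p%:R <= k%:R * c * p%:R by rewrite ler_pM2r.
have h3 : 0 <= (k%:R - 1) * (d * p%:R - 1).
  by rewrite mulr_ge0 ?subr_ge0 ?ler1n ?(ltnW hk) ?(ltW dp).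
lra.
Qed.
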